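(* Let $s \ge 1$ and $r \ge 2$ be integers. For all $n \ge 2s+2$, $$ \mathrm{ex}_r(n,\mathcal{B}M_{s+1})= \begin{cases} \max\left\{ \binom{2s+1}{r},\ \binom{s}{r-1}(n-s)+\binom{s}{r}\right\}, & \text{if } r \le s+1;\\[4pt] \binom{2s+1}{r}, & \text{if } s+2 \le r \le 2s;\\[4pt] s, & \text{if } r \ge 2s+1. \end{cases} $$
   Context: A hypergraph $\mathcal{H}=(V(\mathcal{H}),E(\mathcal{H}))$ consists of a finite vertex set $V(\mathcal{H})$ and a family $E(\mathcal{H})$ of subsets of $V(\mathcal{H})$, called hyperedges. For an integer $r\ge 2$, it is $r$-uniform (an $r$-graph) if every hyperedge contains exactly $r$ vertices. All $r$-graphs are simple (no loops and no multiple hyperedges). For a graph $F$ and an $r$-graph $\mathcal{F}$, we say that $\mathcal{F}$ is a Berge copy of $F$ (a Berge-$F$) if $V(F)\subseteq V(\mathcal{F})$ and there is a bijection $\phi:E(F)\to E(\mathcal{F})$ such that $e\subseteq \phi(e)$ for each $e\in E(F)$. The collection of all ($r$-uniform) Berge copies of $F$ is denoted $\mathcal{B}F$. $M_{s+1}$ denotes the matching of size $s+1$, i.e. the graph consisting of $s+1$ independent (pairwise disjoint) edges. Given a family $\mathcal{F}$ of $r$-graphs, an $r$-graph is $\mathcal{F}$-free if it contains no member of $\mathcal{F}$ as a subhypergraph. The Turán number $\mathrm{ex}_r(n,\mathcal{F})$ is the maximum number of hyperedges in an $\mathcal{F}$-free $r$-graph on $n$ vertices. For non-negative integers $a,b$,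 $\binom{a}{b}$ is the binomial coefficient, with $\binom{a}{b}=0$ if $a<b$.
   Formalization: In the case r ≥ 2s+1 the formal theorem additionally assumes s ≤ C(n,r), since otherwise fewer than s hyperedges exist and the claim fails (e.g. s=1, n=4, r=5 gives 0, not 1). *)

(* Defs.v *)
From mathcomp Require Import all_boot.
From mathcomp Require Import boolp.

Set Implicit Arguments.
Unset Strict Implicit.
Unset Printing Implicit Defensive.

(* The vertex set is the whole finite type V.  Edges form a set of sets, so
   there are no multiple hyperedges.  A graph is the 2-uniform case. *)
Definition hypergraph (V : finType) := {set {set V}}.

Definition uniform (V : finType) (r : nat) (H : hypergraph V) : Prop :=
  forall e, e \in H -> #|e| = r.

(* V(F) is identified with a subset of V(B) along the injection f. *)
Definition berge_copy (W U : finType) (F : hypergraph W) (B : hypergraph U)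
    : Prop :=
  exists (f : W -> U) (phi : {set W} -> {set U}),
    [/\ injective f,
        {in F &, injective phi},
        phi @: F = B
      & forall e, e \in F -> f @: e \subset phi e].

Definition subhypergraph (U V : finType) (B : hypergraph U) (H : hypergraph V)
    : Prop :=
  exists g : U -> V, injective g /\ forall e, e \in B -> g @: e \in H.

Definition hypergraph_family := forall U : finType, hypergraph U -> Prop.

Definition berge_family (r : nat) (W : finType) (F : hypergraph W)
    : hypergraph_family :=
  fun U B => uniform r B /\ berge_copy F B.

Definition family_free (fam : hypergraph_family) (V : finType)
    (H : hypergraph V) : Prop :=
  forall (U : finType) (B : hypergraph U), fam U B -> ~ subhypergraph B H.

Definition turan_number (r n : nat) (fam : hypergraph_family) : nat :=
  \max_(H : hypergraph 'I_n | `[< uniform r H /\ family_free fam H >]) #|H|.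

(* M_k on 2k vertices: the i-th edge joins (i, false) and (i, true). *)
Definition matching (k : nat) : hypergraph ('I_k * bool)%type :=
  [set [set (i, false); (i, true)] | i : 'I_k].

(* Main.v *)
Require Import Defs.
From mathcomp Require Import all_boot fingroup perm boolp.
From mathcomp Require Import zify.

(** The theorem rests on a min-max formula for Berge matchings.  Choosing [s + 1]
    disjoint pairs in [s + 1] distinct hyperedges of [H] is an ordinary matching
    problem in an auxiliary graph, where each hyperedge is replaced by two
    adjacent copies joined to all its vertices.  The Tutte-Berge formula of that
    graph ([tutte_berge], obtained from Gallai's lemma [entangled_trans]) says
    that if [H] has no Berge matching of size [s + 1], there are a vertex set [S],
    a set [T] of hyperedges and a partition of the vertices outside [S] into
    classes [C_i] such that every hyperedge outside [T] lies in some [S u C_i] and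
    [|S| + |T| + sum_i floor(|C_i| / 2) <= s] ([berge_barrier]).

    It remains to count.  With [k = |S|] and [t = |T|] fixed, the number of
    [r]-subsets of the sets [S u C_i] is largest, by convexity, when one class has
    size [2(s - t - k) + 1] and the others are singletons
    ([card_class_confined]).  The resulting bound is convex in [k]: at [k = 0] it
    counts a clique on [2(s - t) + 1] vertices, at [k = s - t] the sets with at
    most one vertex outside a set of size [s - t].  Finally, replacing the [t]
    hyperedges of [T] by a larger clique or star never loses, unless the clique or
    star is too small to contain a hyperedge; then at most [s] hyperedges remain
    ([barrier_count_bound]).

    So a Berge-matching-free hypergraph has at most the maximum of [s],
    ['C(2s+1, r)] and ['C(s, r-1) (n-s) + 'C(s, r)] hyperedges.  Each value is
    attained, by [s] arbitrary hyperedges, by a clique and by a star, and in each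
    range of [r] comparing the three gives the stated answer. *)

Set Implicit Arguments.
Unset Strict Implicit.
Unset Printing Implicit Defensive.

(** * Cardinals as sums *)

Lemma card_sum_bool (T : finType) (P : pred T) : #|[set x | P x]| = \sum_x P x.
Proof. by rewrite -sum1dep_card big_mkcond; apply: eq_bigr => x _; case: (P x). Qed.

Lemma card_sum_mem (T : finType) (A : {set T}) : #|A| = \sum_x (x \in A).
Proof. by rewrite -card_sum_bool; apply: eq_card => x; rewrite inE. Qed.

Lemma card_bigcup_le (I T : finType) (E : I -> {set T}) :
  #|\bigcup_i E i| <= \sum_i #|E i|.
Proof.
elim/big_ind2: _ => [|A a B b hA hB|//]; first by rewrite cards0.
by apply: leq_trans (leq_add hA hB); rewrite leq_card_setU.
Qed.

(** * The Tutte-Berge formula *)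

Section Graph.
Variables (X : finType) (e : rel X).
Hypothesis e_sym : symmetric e.
Implicit Types (A K : {set X}) (s M N : {perm X}).

(** A matching inside [A] is the involution exchanging the two ends of each of
    its edges; the unmatched vertices are its fixed points.  Recombining two
    matchings then amounts to gluing two functions. *)
Definition graph_matching A s :=
  [&& [forall x, s (s x) == x], perm_on A s & [forall x, (s x != x) ==> e x (s x)]].

Definition covered s := [set x | s x != x].

(** Matchings are measured by the number of vertices that they cover, which is
    twice their number of edges. *)
Definition matching_number A := \max_(s | graph_matching A s) #|covered s|.

Lemma graph_matchingP A s :
  reflect [/\ involutive s, covered s \subset A & forall x, s x != x -> e x (s x)]
          (graph_matching A s).
Proof.
apply: (iffP and3P) => [[/forallP h1 h2 /forallP h3]|[h1 h2 h3]]; split.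
- by move=> x; apply/eqP.
- by apply: subset_trans h2; apply/subsetP => x; rewrite !inE.
- by move=> x; apply/implyP.
- by apply/forallP => x; rewrite h1.
- by apply: subset_trans h2; apply/subsetP => x; rewrite !inE.
- by apply/forallP => x; apply/implyP/h3.
Qed.

Lemma maximum_matching_exists A :
  exists2 s, graph_matching A s & #|covered s| = matching_number A.
Proof.
have ne : 0 < #|graph_matching A|.
  apply/card_gt0P; exists 1%g; apply/graph_matchingP; split.
  - by move=> x; rewrite !perm1.
  - by apply/subsetP => x; rewrite inE perm1 eqxx.
  - by move=> x; rewrite perm1 eqxx.
by case: (eq_bigmax_cond (fun s => #|covered s|) ne) => s hs eqs; exists s.
Qed.

Lemma card_covered_le A s :
  graph_matching A s -> #|covered s| <= matching_number A.
Proof. by move=> hs; rewrite /matching_number (bigD1 s) /= ?leq_maxl. Qed.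

(** In each orbit [{x, f x}] exactly one point precedes its image in the
    enumeration of [X]. *)
Lemma fixfree_involution_even (f : X -> X) K :
  involutive f -> {in K, forall x, f x \in K} -> {in K, forall x, f x != x} ->
  ~~ odd #|K|.
Proof.
move=> fK fclosed fixfree.
pose L := [set x in K | enum_rank x < enum_rank (f x)].
have -> : #|K| = #|L| + #|f @: L|.
  rewrite -(cardsID L K); congr (_ + _).
    by apply: eq_card => x; rewrite !inE; case: (x \in K).
  apply: eq_card => x; rewrite !inE.
  apply/andP/imsetP => [[hx xK]|[y]].
    exists (f x); last by rewrite fK.
    rewrite inE fclosed // fK.
    move: hx; rewrite xK /= -leqNgt leq_eqVlt => /orP[/eqP/val_inj/enum_rank_inj h|//].
    by move: (fixfree x xK); rewrite h eqxx.
  rewrite inE => /andP[yK hy] ->; rewrite fK; split; last exact: fclosed.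
  by rewrite negb_and -leqNgt ltnW ?orbT.
by rewrite card_imset ?addnn ?odd_double //; apply: inv_inj.
Qed.

Lemma card_covered_even A s : graph_matching A s -> ~~ odd #|covered s|.
Proof.
case/graph_matchingP => sK _ _; apply: (fixfree_involution_even sK) => x.
  by rewrite !inE sK eq_sym.
by rewrite inE.
Qed.

Lemma matching_number_even A : ~~ odd (matching_number A).
Proof. by have [s hs <-] := maximum_matching_exists A; apply: card_covered_even hs. Qed.

(** Gluing is possible along any set that is a union of components of the
    symmetric difference of the two matchings, whence the closure hypotheses. *)
Lemma graph_matching_mix A K M N :
  graph_matching A M -> graph_matching A N ->
  {in K, forall x, M x \in K} -> {in K, forall x, N x \in K} ->
  exists2 s, graph_matching A s & forall x, s x = if x \in K then N x else M x.
Proof.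
move=> /graph_matchingP[MK MA Me] /graph_matchingP[NK NA Ne] cM cN.
pose mix x := if x \in K then N x else M x.
have mixK : involutive mix.
  rewrite /mix => x; case: (boolP (x \in K)) => xK; first by rewrite cN // NK.
  by rewrite ifN ?MK //; apply: contra xK => /cM; rewrite MK.
have sE : forall x, perm (inv_inj mixK) x = mix x by move=> x; rewrite permE.
exists (perm (inv_inj mixK)) => //; apply/graph_matchingP; split.
- by move=> x; rewrite !sE mixK.
- apply/subsetP => x; rewrite inE sE /mix; case: ifP => _ hx.
    by apply: (subsetP NA); rewrite inE.
  by apply: (subsetP MA); rewrite inE.
- by move=> x; rewrite sE /mix; case: ifP => _; [apply: Ne|apply: Me].
Qed.

Definition maximum_matching A s := graph_matching A s && (#|covered s| == matching_number A).

(** The gluing of [M] and [N] along [K] and the opposite gluing together cover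
    as many vertices as [M] and [N]; since neither exceeds the maximum, both
    reach it. *)
Lemma maximum_matching_mix A K M N :
  maximum_matching A M -> maximum_matching A N ->
  {in K, forall x, M x \in K} -> {in K, forall x, N x \in K} ->
  exists2 s, maximum_matching A s & forall x, s x = if x \in K then N x else M x.
Proof.
move=> /andP[gM /eqP cM] /andP[gN /eqP cN] iM iN.
have [s gs sE] := graph_matching_mix gM gN iM iN.
have [s' gs' sE'] := graph_matching_mix gN gM iN iM.
have: #|covered s| + #|covered s'| = #|covered M| + #|covered N|.
  rewrite -(cardsID K (covered s)) -(cardsID K (covered s')).
  rewrite -(cardsID K (covered M)) -(cardsID K (covered N)).
  have -> : covered s :&: K = covered N :&: K.
    by apply/setP => x; rewrite !inE sE; case: (x \in K); rewrite ?andbF.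
  have -> : covered s :\: K = covered M :\: K.
    by apply/setP => x; rewrite !inE sE; case: (x \in K).
  have -> : covered s' :&: K = covered M :&: K.
    by apply/setP => x; rewrite !inE sE'; case: (x \in K); rewrite ?andbF.
  have -> : covered s' :\: K = covered N :\: K.
    by apply/setP => x; rewrite !inE sE'; case: (x \in K).
  lia.
have := card_covered_le gs; have := card_covered_le gs'.
move=> h1 h2 h3; exists s => //; rewrite /maximum_matching gs /=; lia.
Qed.

(** Three vertices each missed by [M] or [N] cannot lie on one component of the
    union of [M] and [N], because such a component is a path or a cycle.  The
    component [K] of [t] is the orbit of [t] under [p = M o N]: since [N] fixes
    [t], [N] sends [p^i t] to [p^-i t] and [M] sends it to [p^(1-i) t].  A fixed
    point [p^i t] of [M] thus satisfies [p^(2i) t = p t], and two such points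
    must coincide. *)
Lemma alternating_component M N t u v :
  involutive M -> involutive N -> N t = t -> M u = u -> M v = v -> u != v ->
  exists K, [/\ {in K, forall x, M x \in K}, {in K, forall x, N x \in K},
               t \in K & (u \notin K) || (v \notin K)].
Proof.
move=> MK NK Nt Mu Mv uv.
have [p MN] : exists p : {perm X}, forall x, p x = M (N x).
  by exists (N * M)%g => x; rewrite permM.
have Np i : N ((p ^+ i)%g t) = ((p^-1) ^+ i)%g t.
  elim: i => [|i IH]; first by rewrite !expg0 !perm1.
  rewrite !expgSr !permM MN; apply: (perm_inj (s := p)).
  by rewrite permKV -IH MN NK MK.
have Mp i : M ((p ^+ i)%g t) = p (((p^-1) ^+ i)%g t).
  by rewrite -Np MN NK.
have inK (i : nat) : ((p^-1) ^+ i)%g t \in porbit p t.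
  by rewrite -porbitV mem_porbit.
exists (porbit p t); split.
- move=> _ /porbitP[[|i] ->]; rewrite Mp.
    by rewrite expg0 perm1; have := mem_porbit p 1 t; rewrite expg1.
  by rewrite expgSr permM permKV inK.
- by move=> _ /porbitP[i ->]; rewrite Np inK.
- exact: porbit_id.
rewrite -negb_and; apply/negP => /andP[/porbitP[i ui] /porbitP[j vj]].
have fixodd k w : w = (p ^+ k)%g t -> M w = w -> (p ^+ (2 * k))%g t = p t.
  move=> ->; rewrite Mp mul2n -addnn expgD permM => <-.
  by rewrite -permM -expgS expgSr permM expgVn permKV.
have h1 := fixodd _ _ ui Mu; have h2 := fixodd _ _ vj Mv.
wlog ij : i j u v uv Mu Mv ui vj h1 h2 / i <= j.
  move=> W; case: (leqP i j) => [|/ltnW] le; first exact: (W i j u v).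
  by apply: (W j i v u) => //; rewrite eq_sym.
(* [q] sends [u] to [v].  On [t] it agrees with its power of exponent [2 * i],
   while [q ^ 2] fixes [t]; hence [q] fixes [t], and [u] as well. *)
have [q qE] : exists q, q = (p ^+ (j - i))%g by exists (p ^+ (j - i))%g.
have qq : (q ^+ 2)%g t = t.
  apply: (perm_inj (s := (p ^+ (2 * i))%g)).
  rewrite qE -expgM -permM -expgD h1.
  by rewrite (_ : _ + _ = 2 * j) //; lia.
have qi m : (q ^+ (2 * m))%g t = t.
  elim: m => [|m IH]; first by rewrite expg0 perm1.
  by rewrite mulnS expgD permM qq.
have pp : forall m, ((p ^+ (2 * i)) ^+ m)%g t = (p ^+ m)%g t.
  elim=> [|m IH]; first by rewrite !expg0.
  rewrite expgSr permM IH -permM -expgD addnC expgD permM h1.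
  by rewrite -permM -expgS.
have qt : q t = t.
  by rewrite {1}qE -pp -expgM mulnC expgM -qE qi.
case/negP: uv; apply/eqP; rewrite ui vj.
have -> : (p ^+ j)%g = (q * p ^+ i)%g by rewrite qE -expgD subnK.
by rewrite permM qt.
Qed.

Lemma unmatched_edge_not_maximum A M x y :
  graph_matching A M -> x \in A -> y \in A -> x != y -> e x y ->
  M x = x -> M y = y -> #|covered M| < matching_number A.
Proof.
move=> /graph_matchingP[MK MA Me] xA yA xy exy Mx My.
pose N := (M * tperm x y)%g.
have NE z : z != x -> z != y -> N z = M z.
  move=> zx zy; rewrite permM tpermD //; apply/negP => /eqP h.
    by case/negP: zx; rewrite -(MK z) -h Mx.
  by case/negP: zy; rewrite -(MK z) -h My.
have Nx : N x = y by rewrite permM Mx tpermL.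
have Ny : N y = x by rewrite permM My tpermR.
have gN : graph_matching A N.
  apply/graph_matchingP; split.
  - move=> z; case: (eqVneq z x) => [->|zx]; first by rewrite Nx Ny.
    case: (eqVneq z y) => [->|zy]; first by rewrite Ny Nx.
    rewrite NE // NE ?MK //; apply/negP => /eqP h.
      by case/negP: zx; rewrite -(MK z) h Mx.
    by case/negP: zy; rewrite -(MK z) h My.
  - apply/subsetP => z; rewrite inE.
    case: (eqVneq z x) => [->//|zx]; case: (eqVneq z y) => [->//|zy].
    by rewrite NE // => h; apply: (subsetP MA); rewrite inE.
  - move=> z; case: (eqVneq z x) => [->|zx]; first by rewrite Nx.
    case: (eqVneq z y) => [->|zy]; first by rewrite Ny e_sym.
    by rewrite NE //; apply: Me.
apply: leq_trans (card_covered_le gN); apply/proper_card/properP; split.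
  apply/subsetP => z; rewrite !inE => h.
  rewrite NE //; apply: contra h => /eqP->; apply/eqP => //.
by exists x; rewrite !inE ?Nx ?Mx ?eqxx // eq_sym.
Qed.

(** When every vertex is missed by some maximum matching, this is an equivalence
    relation (Gallai); its classes play the role of the components in the
    Tutte-Berge formula. *)
Definition entangled A u v :=
  (u == v) || [forall s, maximum_matching A s ==> ~~ ((s u == u) && (s v == v))].

Lemma entangledP A u v :
  reflect (u = v \/ forall s, maximum_matching A s -> s u = u -> s v = v -> False)
          (entangled A u v).
Proof.
apply: (iffP orP) => [[/eqP|/forallP h]|[->|h]]; [by left | right | by left | right].
  by move=> s ms su sv; have := h s; rewrite ms su sv !eqxx.
apply/forallP => s; apply/implyP => ms; apply/negP => /andP[/eqP su /eqP sv].
exact: h ms su sv.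
Qed.

Lemma entangled_sym A : symmetric (entangled A).
Proof.
move=> u v; apply/entangledP/entangledP => -[->|h]; try by left.
  by right=> s ? ? ?; apply: (h s).
by right=> s ? ? ?; apply: (h s).
Qed.

(** Gallai's lemma.  If a maximum matching [M] misses both [u] and [v] while [N]
    misses [t], one of [u], [v] lies outside the component [K] of [t]; using [N]
    on [K] and [M] elsewhere gives a maximum matching that misses both [t] and
    that vertex. *)
Lemma entangled_trans A t u v :
  (exists2 N, maximum_matching A N & N t = t) ->
  entangled A u t -> entangled A t v -> entangled A u v.
Proof.
move=> [N mN Nt] /entangledP ut /entangledP tv; apply/entangledP.
case: ut => [->//|ut]; case: tv => [<-|tv]; first by right.
case: (eqVneq u v) => [->|uv]; [by left|right => M mM Mu Mv].
have MK : involutive M by case/andP: (mM) => /graph_matchingP[].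
have NK : involutive N by case/andP: (mN) => /graph_matchingP[].
have [K [cM cN tK uvK]] := alternating_component MK NK Nt Mu Mv uv.
have [s ms sE] := maximum_matching_mix mM mN cM cN.
have st : s t = t by rewrite sE tK.
case/orP: uvK => wK.
  by apply: (ut s) => //; rewrite sE (negbTE wK).
by apply: (tv s) => //; rewrite sE (negbTE wK).
Qed.

(** A maximum matching stays inside the classes and misses at most one vertex of
    each, so it covers at least [2 * floor(c / 2)] vertices of a class of size
    [c]. *)
Lemma matching_number_classes A (cl : X -> X) :
  (forall x y, x \in A -> y \in A -> e x y -> cl x = cl y) ->
  (forall x y, x \in A -> y \in A -> cl x = cl y -> entangled A x y) ->
  \sum_c (#|[set x in A | cl x == c]|./2).*2 <= matching_number A.
Proof.
move=> ecl clent; have [s gs cs] := maximum_matching_exists A.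
have ms : maximum_matching A s by rewrite /maximum_matching gs cs eqxx.
have /graph_matchingP[sK sA se] := gs; rewrite -cs.
rewrite -sum1_card [leqRHS](partition_big cl xpredT) //=; apply: leq_sum => c _.
set C := [set x in A | cl x == c].
rewrite sum1dep_card.
have -> : #|[set x | (x \in covered s) && (cl x == c)]| = #|C :&: covered s|.
  apply: eq_card => x; rewrite !inE; case: (boolP (s x == x)) => //= h; rewrite ?andbF //.
  by rewrite andbT (subsetP sA) // inE.
have ev : ~~ odd #|C :&: covered s|.
  apply: (fixfree_involution_even sK) => x; rewrite !inE => /andP[/andP[xA /eqP cx] mx] //.
  have sxA : s x \in A by apply: (subsetP sA); rewrite inE sK eq_sym.
  by rewrite sxA sK (eq_sym x) mx andbT -cx eq_sym; apply/eqP/ecl => //; apply: se.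
have le1 : #|C :\: covered s| <= 1.
  apply/card_le1_eqP => x y; rewrite !inE !negbK.
  move=> /andP[/eqP sx /andP[xA /eqP cx]] /andP[/eqP sy /andP[yA /eqP cy]].
  have /entangledP[//|h] := clent x y xA yA (etrans cx (esym cy)).
  by case: (h s).
have := cardsID (covered s) C; lia.
Qed.

(** The nontrivial half of the Tutte-Berge formula: a set [U] certifies the
    matching number, the classes of [cl] outside [U] being unions of connected
    components.  If deleting some vertex [v] decreases the matching number, the
    decrease is at least 2 by parity and pays for putting [v] into [U];
    otherwise every vertex is missed by a maximum matching and Gallai's lemma
    applies with [U] empty. *)
Lemma tutte_berge A :
  exists (U : {set X}) (cl : X -> X),
    (forall x y, x \in A :\: U -> y \in A :\: U -> e x y -> cl x = cl y) /\
    #|U|.*2 + \sum_c (#|[set x in A :\: U | cl x == c]|./2).*2 <= matching_number A.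
Proof.
have [k leAk] := ubnP #|A|; elim: k A leAk => // k IH A leAk.
case: (boolP [exists v in A, matching_number (A :\ v) < matching_number A]).
  case/existsP => v /andP[vA lt].
  case: (IH (A :\ v)) => [|U [cl [ecl le]]].
    by move: leAk; rewrite (cardsD1 v) vA.
  have AE : A :\: (v |: U) = A :\ v :\: U by rewrite setDDl.
  exists (v |: U), cl; rewrite AE; split => //.
  have vU : #|v |: U| <= #|U|.+1 by rewrite cardsU1; case: (_ \notin _).
  have := matching_number_even A; have := matching_number_even (A :\ v); lia.
move=> /existsPn nex.
have missed v : v \in A -> exists2 s, maximum_matching A s & s v = v.
  move=> vA; have := nex v; rewrite vA /= -leqNgt => le.
  have [s gs cs] := maximum_matching_exists (A :\ v).
  have /graph_matchingP[sK sA se] := gs.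
  have gs' : graph_matching A s.
    by apply/graph_matchingP; split => //; apply: subset_trans sA (subsetDl _ _).
  exists s; first by rewrite /maximum_matching gs' eqn_leq card_covered_le //= cs.
  apply/eqP/negPn/negP => h; have: v \in covered s by rewrite inE.
  by move/(subsetP sA); rewrite !inE eqxx.
pose cl x := odflt x [pick y in A | entangled A x y].
have clP x : x \in A -> (cl x \in A) && entangled A x (cl x).
  move=> xA; rewrite /cl; case: pickP => [y|/(_ x)] //=.
  by rewrite xA /entangled eqxx.
have clE x y : x \in A -> y \in A -> entangled A x y -> cl x = cl y.
  move=> xA yA xy; rewrite /cl.
  have -> : [pick z in A | entangled A x z] = [pick z in A | entangled A y z].
    apply: eq_pick => z; case: (boolP (z \in A)) => //= zA; apply/idP/idP => h.
      by apply: (entangled_trans (missed x xA)) h; rewrite entangled_sym.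
    exact: (entangled_trans (missed y yA)) h.
  by case: pickP => // /(_ y); rewrite yA /entangled eqxx.
have ecl x y : x \in A -> y \in A -> e x y -> cl x = cl y.
  move=> xA yA exy; apply: clE => //; apply/entangledP.
  case: (eqVneq x y) => [->|xy]; [by left|right => s /andP[gs /eqP cs] sx sy].
  by have := unmatched_edge_not_maximum gs xA yA xy exy sx sy; rewrite cs ltnn.
exists set0, cl; rewrite setD0 cards0; split => //.
apply: matching_number_classes => // x y xA yA clxy.
have /andP[cA xc] := clP x xA; have /andP[_ yc] := clP y yA.
by apply: (entangled_trans (missed _ cA)) => //; rewrite clxy entangled_sym.
Qed.

End Graph.

(** * Barriers for Berge matchings *)

Section Berge.
Variable V : finType.
Implicit Types (H : {set {set V}}) (h : {set V}).

(** The pair [{w h true, w h false}] is the graph edge chosen inside the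
    hyperedge [h]. *)
Definition disjoint_pairs H (w : {set V} -> bool -> V) :=
  (forall h b, h \in H -> w h b \in h) /\
  (forall h b h' b', h \in H -> h' \in H -> w h b = w h' b' -> (h, b) = (h', b')).

(** Absence of a Berge copy of a matching of size [s + 1], in a form free of the
    index type of that matching. *)
Definition berge_bounded H s :=
  forall H' w, H' \subset H -> disjoint_pairs H' w -> #|H'| <= s.

(** The auxiliary graph turns Berge matchings into matchings: a hyperedge [h] of
    [H] is replaced by two adjacent copies, both joined to all the vertices of
    [h].  A copy pair contributes one edge when it is matched internally and two
    when both copies are matched into [h], so a maximum matching has size [#|H|]
    plus the size of a largest Berge matching.  The copies of a set outside [H]
    are isolated. *)
Definition aux_vertex : finType := (V + {set V} * bool)%type.

Definition aux_edge H (x y : aux_vertex) :=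
  match x, y with
  | inl v, inr (h, _) | inr (h, _), inl v => (h \in H) && (v \in h)
  | inr (h, b), inr (h', b') => [&& h \in H, h == h' & b != b']
  | inl _, inl _ => false
  end.

Lemma aux_edge_sym H : symmetric (aux_edge H).
Proof.
move=> [v|[h b]] [v'|[h' b']] //=.
by rewrite (eq_sym b) (eq_sym h); case: eqP => [->|_]; rewrite ?andbF.
Qed.

Definition is_vertex (x : aux_vertex) := if x is inl _ then true else false.

(** The hyperedges whose two copies are both matched to vertices form a Berge
    matching.  Any other hyperedge accounts for at most two covered vertices,
    counting its covered copies and the vertices of [V] matched to them. *)
Lemma aux_matching_bound H s :
  berge_bounded H s -> matching_number (aux_edge H) setT <= (#|H| + s).*2.
Proof.
move=> Hs; have [m gm <-] := maximum_matching_exists (aux_edge H) setT.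
have /graph_matchingP[mK _ me] := gm.
pose hit h b := is_vertex (m (inr (h, b))).
pose H' := [set h in H | hit h true && hit h false].
have hitP h b : hit h b -> (h \in H) /\ exists2 v, m (inr (h, b)) = inl v & v \in h.
  rewrite /hit; case E: (m _) => [v|//] _.
  have := me (inr (h, b)); rewrite E /= => /(_ isT) /andP[hH vh].
  by split => //; exists v.
have H's : #|H'| <= s.
  have [v0 _|noV] := pickP (@predT V); last first.
    suff -> : H' = set0 by rewrite cards0.
    apply/setP => h; rewrite !inE; apply/negP => /and3P[_ /hitP[_ [v]]].
    by have := noV v.
  pose w h b := if m (inr (h, b)) is inl v then v else v0.
  have hit' h b : h \in H' -> hit h b by rewrite inE => /and3P[_ ? ?]; case: b.
  have wE h b : h \in H' -> m (inr (h, b)) = inl (w h b) /\ w h b \in h.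
    by move=> /(hit' h b)/hitP[_ [v mv vh]]; rewrite /w mv.
  apply: (Hs H' w); first by apply/subsetP => h; rewrite inE => /andP[].
  split=> [h b /(wE h b)[]//|h b h' b' hH hH' ww].
  have [E1 _] := wE h b hH; have [E2 _] := wE h' b' hH'.
  have: m (inr (h, b)) = m (inr (h', b')) by rewrite E1 E2 ww.
  by move/perm_inj => [-> ->].
pose B := [set x | is_vertex x && (m x != x)].
pose C := [set x | ~~ is_vertex x && (m x != x)].
pose C' := [set x | ~~ is_vertex x && is_vertex (m x)].
have BC' : #|B| <= #|C'|.
  rewrite -(card_imset _ (@perm_inj _ m)); apply/subset_leq_card/subsetP => x.
  case/imsetP => y; rewrite !inE => /andP[vy my] ->; rewrite mK vy andbT.
  have := me y my; case: y vy my => [v _ _|//].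
  by case: (m _).
have -> : #|covered m| = #|B| + #|C|.
  rewrite -(cardsID [set x | is_vertex x]); congr (_ + _); apply: eq_card => x.
    by rewrite !inE andbC.
  by rewrite !inE.
apply: leq_trans (_ : #|C'| + #|C| <= _); first by rewrite leq_add2r.
rewrite /C /C' !card_sum_bool -big_split /= big_sumType /= big1 ?add0n //.
rewrite (eq_bigr (fun p : {set V} * bool =>
   (fun h b => hit h b + (m (inr (h, b)) != inr (h, b))) p.1 p.2)); last by case.
rewrite -(pair_big xpredT xpredT (fun h b => hit h b + (m (inr (h, b)) != inr (h, b)))) /=.
apply: leq_trans (_ : \sum_h ((h \in H) + (h \in H')).*2 <= _); last first.
  have -> : \sum_h ((h \in H) + (h \in H')).*2 = (\sum_h (h \in H) + \sum_h (h \in H')).*2.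
    by rewrite -big_split -muln2 big_distrl; apply: eq_bigr => h _; rewrite -muln2.
  by rewrite -!card_sum_mem leq_double leq_add2l.
apply: leq_sum => h _; rewrite big_bool /=.
have inH b : m (inr (h, b)) != inr (h, b) -> h \in H.
  by move/me => /=; case: (m _) => [v|[h' b']] /andP[].
(* The only neighbour of a copy besides vertices is its twin. *)
have partner b : hit h b -> ~~ hit h (~~ b) -> m (inr (h, ~~ b)) = inr (h, ~~ b).
  move=> hb nhb; apply/eqP/negPn/negP => mv; have := me _ mv.
  case E: (m (inr (h, ~~ b))) nhb => [v|[h' b']]; first by rewrite /hit E.
  move=> _ /and3P[_ /eqP hh' bb']; subst h'.
  have b'E : b' = b by case: b b' bb' {hb mv E} => [] [].
  by move: hb; rewrite /hit -b'E -E mK.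
have moved b : hit h b -> m (inr (h, b)) != inr (h, b).
  by move/hitP => [_ [v -> _]].
have -> : (h \in H') = hit h true && hit h false.
  rewrite inE; case: (boolP (hit h true)) => [h1|]; last by rewrite andbF.
  by rewrite (inH true) ?moved.
have := partner true; have := partner false; have := moved true; have := moved false.
have := inH true; have := inH false.
move: (m (inr (h, true)) =P inr (h, true)) => [->|n1];
move: (m (inr (h, false)) =P inr (h, false)) => [->|n2];
case: (hit h true) (hit h false) => [] [] /=; case: (h \in H) => //=; intuition.
Qed.

(** The Tutte-Berge formula of the auxiliary graph read on the hypergraph.  [S]
    is the vertex part of the barrier and [T] the set of hyperedges both of whose
    copies are in the barrier; any other hyperedge keeps a copy adjacent to all
    its vertices, which are therefore, outside [S], in a single class.  In the
    count, two surviving copies add 1 to the half-size of their class and each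
    copy in the barrier costs 1, so that every hyperedge is paid for once and
    those of [T] twice. *)
Lemma berge_barrier H s : berge_bounded H s ->
  exists (S : {set V}) (T : {set {set V}}) (L : finType) (cl : V -> L),
    [/\ forall h, h \in H :\: T -> exists c, forall v, v \in h -> v \notin S -> cl v = c
      & #|S| + #|T| + \sum_c #|[set v in ~: S | cl v == c]|./2 <= s].
Proof.
move=> Hs; have [U [cl [ecl le]]] := tutte_berge (@aux_edge_sym H) setT.
pose deleted h b := inr (h, b) \in U.
pose S := [set v | inl v \in U].
pose T := [set h in H | deleted h true && deleted h false].
exists S, T, aux_vertex, (fun v => cl (inl v)); split.
  move=> h; rewrite !inE => /andP[hT hH].
  have [b hb] : exists b, ~~ deleted h b.
    by move: hT; rewrite hH /= negb_and => /orP[] hb; [exists true|exists false].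
  exists (cl (inr (h, b))) => v vh; rewrite inE => vS.
  by apply: ecl; rewrite ?inE ?vS ?hb //= hH vh.
have := leq_trans le (aux_matching_bound Hs).
pose whole h := [&& h \in H, ~~ deleted h true & ~~ deleted h false].
have classE c : #|[set v in ~: S | cl (inl v) == c]|./2 +
    \sum_h (whole h && (cl (inr (h, true)) == c)) <=
    #|[set x in [set: aux_vertex] :\: U | cl x == c]|./2.
  suff : #|[set v in ~: S | cl (inl v) == c]| +
      (\sum_h (whole h && (cl (inr (h, true)) == c))).*2 <=
      #|[set x in [set: aux_vertex] :\: U | cl x == c]|.
    by set a := #|_|; set b := \sum_h _; set d := #|_|; lia.
  rewrite !card_sum_bool big_sumType /=; apply: leq_add.
    by apply: leq_sum => v _; rewrite !inE andbT.
  rewrite (eq_bigr (fun p : {set V} * bool =>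
    (fun h b => ((inr (h, b) \in setT :\: U) && (cl (inr (h, b)) == c) : nat)) p.1 p.2));
    last by case.
  rewrite -(pair_big xpredT xpredT
    (fun h b => ((inr (h, b) \in setT :\: U) && (cl (inr (h, b)) == c) : nat))) /=.
  rewrite -muln2 big_distrl; apply: leq_sum => h _; rewrite big_bool /= muln2.
  case: (boolP (whole h)) => // /and3P[hH h1 h2].
  rewrite !inE -/(deleted h true) -/(deleted h false) h1 h2 /=.
  have <- : cl (inr (h, true)) = cl (inr (h, false)).
    by apply: ecl; rewrite ?inE ?h1 ?h2 //= hH eqxx.
  by rewrite addnn.
have sumwhole : \sum_c \sum_h (whole h && (cl (inr (h, true)) == c)) = \sum_h whole h.
  rewrite exchange_big /=; apply: eq_bigr => k _.
  rewrite (bigD1 (cl (inr (k, true)))) //= eqxx big1 ?andbT ?addn0 // => c.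
  by rewrite eq_sym => /negbTE->; rewrite andbF.
have classes := leq_sum (index_enum _) (fun c _ => classE c : _) (P := xpredT).
rewrite big_split /= sumwhole in classes.
have UE : #|S| + \sum_h ((h \in H) * (deleted h true + deleted h false)) <= #|U|.
  rewrite [X in _ <= X]card_sum_mem big_sumType /=; apply: leq_add.
    by rewrite card_sum_mem; apply: leq_sum => v _; rewrite inE.
  rewrite (eq_bigr (fun p : {set V} * bool => (fun h b => deleted h b : nat) p.1 p.2));
    last by case.
  rewrite -(pair_big xpredT xpredT (fun h b => deleted h b : nat)) /=.
  by apply: leq_sum => h _; rewrite big_bool /=; case: (h \in H); rewrite ?mul1n.
have HT : #|H| + #|T| <= \sum_h ((h \in H) * (deleted h true + deleted h false)) + \sum_h whole h.
  rewrite (card_sum_mem H) (card_sum_mem T) -!big_split; apply: leq_sum => h _.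
  rewrite inE /whole; case: (h \in H); case: (deleted h true); case: (deleted h false) => //.
have -> : \sum_c (#|[set x in [set: aux_vertex] :\: U | cl x == c]|./2).*2 =
  (\sum_c #|[set x in [set: aux_vertex] :\: U | cl x == c]|./2).*2.
  by rewrite -muln2 big_distrl; apply: eq_bigr => c _ /=; rewrite muln2.
move: classes UE HT.
set a := \sum_c _; set b := \sum_h _; set d := \sum_c _; set f := \sum_h _.
lia.
Qed.

End Berge.

(** * Binomial inequalities *)

(** With [#|K| = k] and [Q] disjoint of size [2q + 1], the number of
    [(r + 1)]-subsets of [K u Q] that have at least two elements in [Q]; it is
    written as a sum of increments because these increase with [i], which is
    the convexity used below. *)
Definition excess k r q :=
  \sum_(i < q) ('C(k + i.*2.+1, r) + 'C(k + i.*2.+2, r) - ('C(k, r)).*2).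

Lemma bin_odd_excess k r q :
  'C(k + q.*2.+1, r.+1) = 'C(k, r.+1) + q.*2.+1 * 'C(k, r) + excess k r q.
Proof.
elim: q => [|q IH]; first by rewrite /excess big_ord0 addn1 binS mul1n addn0.
rewrite /excess big_ord_recr /= -/(excess k r q) doubleS.
rewrite (_ : k + q.*2.+3 = (k + q.*2.+1).+2); last lia.
rewrite 2!binS IH.
have := leq_bin2l r (leq_addr q.*2.+1 k); have := leq_bin2l r (leq_addr q.*2.+2 k).
rewrite (_ : k + q.*2.+2 = (k + q.*2.+1).+1); last lia.
nia.
Qed.

Lemma excess_superadditive k r a b : excess k r a + excess k r b <= excess k r (a + b).
Proof.
rewrite {3}/excess big_split_ord /= leq_add2l; apply: leq_sum => i _ /=.
by apply: leq_sub2r; apply: leq_add; apply: leq_bin2l; lia.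
Qed.

Lemma excess_mono k r a b : a <= b -> excess k r a <= excess k r b.
Proof.
by move=> /subnKC <-; apply: leq_trans (excess_superadditive _ _ _ _); apply: leq_addr.
Qed.

(** Equality holds for odd [c]; for even [c] the bound amounts to
    ['C(k, r) <= 'C(k + c, r)]. *)
Lemma bin_excess k r c :
  'C(k + c, r.+1) <= 'C(k, r.+1) + c * 'C(k, r) + excess k r c./2.
Proof.
move: (odd_double_half c); move: (c./2) => q <-.
have := bin_odd_excess k r q; have := leq_bin2l r (leq_addr q.*2 k).
case: (odd c) => /=; first by rewrite add1n => _ <-.
by rewrite add0n addnS binS mulSn; lia.
Qed.

(** The increments [gain - loss] are nondecreasing: before an index where they
    are nonpositive [f] decreases, and after an index where they are positive it
    increases. *)
Lemma convex_max (N : nat) (f loss gain : nat -> nat) :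
  (forall j, j < N -> f j.+1 + loss j = f j + gain j) ->
  (forall i j, i <= j -> j < N -> loss j <= loss i) ->
  (forall i j, i <= j -> j < N -> gain i <= gain j) ->
  forall k, k <= N -> f k <= maxn (f 0) (f N).
Proof.
move=> step lossM gainM [|k] kN; first exact: leq_maxl.
rewrite leq_max; case: (leqP (gain k) (loss k)) => cmp; apply/orP; [left|right].
  suff dn j : j <= k.+1 -> f k.+1 <= f (k.+1 - j) by have := dn k.+1 (leqnn _); rewrite subnn.
  elim: j => [|j IH] jk; first by rewrite subn0.
  apply: leq_trans (IH (ltnW jk)) _; rewrite subSn //.
  have jN : k - j < N by lia.
  have jk' : k - j <= k by lia.
  have := step _ jN; have := lossM _ _ jk' kN; have := gainM _ _ jk' kN.
  rewrite subSS; lia.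
suff up j : k.+1 + j <= N -> f k.+1 <= f (k.+1 + j).
  by have := up (N - k.+1); rewrite subnKC //; apply.
elim: j => [|j IH] jk; first by rewrite addn0.
have jN : k.+1 + j < N by lia.
have jk' : k <= k.+1 + j by lia.
have := step _ jN; have := lossM _ _ jk' jN; have := gainM _ _ jk' jN.
have := IH (ltnW _); rewrite addnS in jk *; move/(_ jk); lia.
Qed.

(** Pascal's rule: passing from [m + t] to [m + t + 1] adds ['C(m + t, r)], which
    is at least 1. *)
Lemma bin_add_le m r t : r.+1 <= m -> 'C(m, r.+1) + t <= 'C(m + t, r.+1).
Proof.
move=> rm; elim: t => [|t IH]; first by rewrite !addn0.
have: 0 < 'C(m + t, r) by rewrite bin_gt0; lia.
rewrite !addnS binS; lia.
Qed.

(** ['C(2s+1, r) >= 2s+2-r], and the same bound holds for [2s+1-r] by symmetry;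
    one of the two suffices, according to the position of [r] relative to [s]. *)
Lemma leq_bin_central s r : 2 <= r -> r <= s.*2 -> s <= 'C(s.*2.+1, r).
Proof.
case: r => // r r1 rs.
case: (leqP r.+1 s) => h.
  have := bin_add_le (s.*2.+1 - r.+1) (leqnn r.+1).
  by rewrite binn subnKC; lia.
rewrite -bin_sub; last lia.
have [q qE] : exists q, s.*2.+1 - r.+1 = q.+1 by exists (s.*2 - r.+1); lia.
have := bin_add_le r.+1 (leqnn q.+1); rewrite qE binn.
by rewrite (_ : q.+1 + r.+1 = s.*2.+1); lia.
Qed.

(** Trading the [t] discarded hyperedges for a larger clique never loses, unless
    the clique is too small to contain a hyperedge, and then at most [s]
    hyperedges remain. *)
Lemma clique_bound_add s t r :
  t <= s -> t + 'C((s - t).*2.+1, r.+1) <= maxn s 'C(s.*2.+1, r.+1).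
Proof.
move=> ts; case: (leqP r.+1 (s - t).*2.+1) => h; last by rewrite bin_small //; lia.
have := bin_add_le t h; have := @leq_bin2l ((s - t).*2.+1 + t) s.*2.+1 r.+1.
lia.
Qed.

(** The number of [(r + 2)]-subsets of an [n]-set that have at most one element
    outside a fixed [k]-subset. *)
Definition star_count n r k := 'C(k, r.+1) * (n - k) + 'C(k, r.+2).

(** The same trade as for cliques: enlarging a centre of size [m >= r] by one
    vertex creates ['C(m, r) * (n - m - 1)] new sets. *)
Lemma star_bound_add n s t r :
  t <= s -> s < n -> t + star_count n r (s - t) <= maxn s (star_count n r s).
Proof.
move=> ts sn; case: (leqP (s - t) r) => h.
  have -> : star_count n r (s - t) = 0 by rewrite /star_count !bin_small; lia.
  lia.
suff up j : s - t + j <= s -> star_count n r (s - t) + j <= star_count n r (s - t + j).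
  by have := up t; rewrite subnK // => /(_ (leqnn _)); lia.
elim: j => [|j IH] js; first by rewrite !addn0.
rewrite addnS in js *; have {}IH := IH (ltnW js).
rewrite addnS; apply: leq_ltn_trans IH _.
set m := s - t + j; rewrite /star_count !binS.
have: 0 < 'C(m, r) by rewrite bin_gt0 /m; lia.
have: 1 < n - m by lia.
have -> : n - m.+1 = (n - m).-1 by lia.
case: (n - m) => [//|d] /=; nia.
Qed.

(** For fixed [t], and [q] as large as the budget [u = s - t] allows, the bound is
    [f k]: one class of size [2(u - k) + 1] together with [S] carries a clique,
    and the other vertices are singletons.  [f] is convex in [k], so one of the
    extremes wins: a clique on [2u + 1] vertices or a star with centre of
    size [u]. *)
Lemma barrier_count_bound n s r k t q :
  s.*2.+1 < n -> k + t + q <= s ->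
  t + ('C(k, r.+2) + (n - k) * 'C(k, r.+1) + excess k r.+1 q) <=
  maxn s (maxn 'C(s.*2.+1, r.+2) (star_count n r s)).
Proof.
move=> sn ktq; pose u := s - t.
apply: leq_trans (_ : t + ('C(k, r.+2) + (n - k) * 'C(k, r.+1) + excess k r.+1 (u - k)) <= _).
  by rewrite !leq_add2l; apply: excess_mono; lia.
pose f j := 'C(u.*2.+1 - j, r.+2) + (n - u.*2.+1 + j) * 'C(j, r.+1).
have ku : k <= u by lia.
have -> : 'C(k, r.+2) + (n - k) * 'C(k, r.+1) + excess k r.+1 (u - k) = f k.
  rewrite /f; have := bin_odd_excess k r.+1 (u - k).
  rewrite (_ : k + (u - k).*2.+1 = u.*2.+1 - k); last lia.
  move=> ->; rewrite (_ : n - k = (u - k).*2.+1 + (n - u.*2.+1 + k)); last lia.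
  by rewrite mulnDl; lia.
have fmax : f k <= maxn (f 0) (f u).
  apply: (@convex_max u f (fun j => 'C(u.*2 - j, r.+1))
    (fun j => (n - u.*2.+1 + j.+1) * 'C(j, r) + 'C(j, r.+1))) => //.
  - move=> j ju; rewrite /f binS subSS (_ : u.*2.+1 - j = (u.*2 - j).+1); last lia.
    by rewrite binS; lia.
  - by move=> i j ij ju; apply: leq_bin2l; lia.
  - by move=> i j ij ju; apply: leq_add; [apply: leq_mul|]; rewrite ?leq_bin2l //; lia.
have f0 : f 0 = 'C(u.*2.+1, r.+2) by rewrite /f subn0 addn0 bin0n muln0 addn0.
have fu : f u = star_count n r u.
  rewrite /f /star_count (_ : u.*2.+1 - u = u.+1); last lia.
  rewrite binS (_ : n - u = (n - u.*2.+1 + u).+1); last lia.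
  by rewrite mulnS mulnC; lia.
have ts : t <= s by lia.
have := clique_bound_add r.+1 ts; have := @star_bound_add n s t r ts.
rewrite -/u -f0 -fu; lia.
Qed.

(** * Counting hyperedges *)

Section Count.
Variable V : finType.
Implicit Types (H : {set {set V}}) (S : {set V}).

Lemma card_fibers (L : finType) (cl : V -> L) (B : {set V}) :
  \sum_c #|[set v in B | cl v == c]| = #|B|.
Proof.
rewrite -sum1_card (partition_big cl xpredT) //=; apply: eq_bigr => c _.
by rewrite sum1dep_card.
Qed.

(** A hyperedge inside [S] is counted once, the others class by class.  By
    superadditivity of the excess, the count is largest when one class holds all
    the excess and the remaining classes are singletons. *)
Lemma card_class_confined (L : finType) (cl : V -> L) H S r :
  uniform r.+1 H ->
  (forall h, h \in H -> exists c, forall v, v \in h -> v \notin S -> cl v = c) ->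
  #|H| <= 'C(#|S|, r.+1) + (#|V| - #|S|) * 'C(#|S|, r) +
          excess #|S| r (\sum_c #|[set v in ~: S | cl v == c]|./2).
Proof.
move=> Hr Hcl; pose C c := [set v in ~: S | cl v == c].
pose sets (A : {set V}) := [set h : {set V} | h \subset A & #|h| == r.+1].
pose E c := sets (S :|: C c) :\: sets S.
have sub : H \subset sets S :|: \bigcup_c E c.
  apply/subsetP => h hH; have [c hc] := Hcl h hH.
  rewrite in_setU; case: (boolP (h \in sets S)) => //= hS.
  apply/bigcupP; exists c => //; rewrite in_setD hS inE Hr // eqxx andbT /=.
  apply/subsetP => v vh; rewrite !inE; case: (boolP (v \in S)) => //= vS.
  by rewrite (hc v).
have Ec c : #|E c| <= #|C c| * 'C(#|S|, r) + excess #|S| r #|C c|./2.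
  have subS : sets S \subset sets (S :|: C c).
    apply/subsetP => h; rewrite !inE => /andP[hS ->]; rewrite andbT.
    by apply: subset_trans hS _; apply: subsetUl.
  rewrite cardsD (setIidPr subS) !cards_draws leq_subLR addnA.
  apply: leq_trans (bin_excess _ _ _); apply: leq_bin2l.
  by rewrite leq_card_setU.
apply: leq_trans (subset_leq_card sub) _.
apply: leq_trans (leq_of_leqif (leq_card_setU _ _)) _; rewrite -addnA.
apply: leq_add; first by rewrite cards_draws.
apply: leq_trans (card_bigcup_le _) _.
apply: leq_trans (leq_sum _ (fun c _ => Ec c)) _.
rewrite big_split /= -big_distrl /= card_fibers cardsCs setCK leq_add2l.
elim/big_ind2: _ => [|x1 x2 y1 y2 h1 h2|//]; first by rewrite /excess big_ord0.
by apply: leq_trans (excess_superadditive _ _ _ _); apply: leq_add.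
Qed.

End Count.

Lemma bounded_upper (V : finType) (H : {set {set V}}) r s :
  s.*2.+1 < #|V| -> uniform r.+2 H -> berge_bounded H s ->
  #|H| <= maxn s (maxn 'C(s.*2.+1, r.+2) (star_count #|V| r s)).
Proof.
move=> sV Hr /berge_barrier[S [T [L [cl [Hcl le]]]]].
apply: leq_trans (barrier_count_bound r sV le).
have Hr' : uniform r.+2 (H :\: T) by move=> h /setDP[hH _]; apply: Hr.
rewrite -(cardsID T H); apply: leq_add; last exact: card_class_confined Hcl.
by apply/subset_leq_card/subsetIr.
Qed.

(** * Constructions without large Berge matchings *)

Lemma bounded_card (V : finType) (H : {set {set V}}) s : #|H| <= s -> berge_bounded H s.
Proof. by move=> Hs H' w /subset_leq_card le _; apply: leq_trans le Hs. Qed.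

(** The pairs of a Berge matching of size [s + 1] would need [2s + 2] vertices. *)
Lemma bounded_ground (V : finType) (H : {set {set V}}) (W : {set V}) s :
  #|W| <= s.*2.+1 -> (forall h, h \in H -> h \subset W) -> berge_bounded H s.
Proof.
move=> Ws HW H' w H'H [wh winj].
have: #|[set w p.1 p.2 | p in setX H' [set: bool]]| <= #|W|.
  apply/subset_leq_card/subsetP => _ /imsetP[[h b] /setXP[hH _] ->].
  by apply: (subsetP (HW h (subsetP H'H _ hH))); apply: wh.
rewrite card_in_imset; last first.
  by move=> [h b] [h' b'] /setXP[hH _] /setXP[hH' _] /winj; apply.
rewrite cardsX cardsT card_bool muln2 => le.
by have := half_leq (leq_trans le Ws); rewrite doubleK /= uphalf_double.
Qed.

(** A pair inside a hyperedge with at most one vertex outside [S] meets [S], and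
    disjoint pairs meet it in different vertices. *)
Lemma bounded_cover (V : finType) (H : {set {set V}}) (S : {set V}) s :
  #|S| <= s -> (forall h, h \in H -> #|h :\: S| <= 1) -> berge_bounded H s.
Proof.
move=> Ss HS H' w H'H [wh winj]; apply: leq_trans Ss.
pose v h := w h (w h true \in S).
have vS h : h \in H' -> v h \in S.
  move=> hH; rewrite /v; case: (boolP (w h true \in S)) => // tS.
  apply/negPn/negP => fS; have /card_le1_eqP le := HS h (subsetP H'H _ hH).
  have := le (w h true) (w h false); rewrite !inE tS fS !wh // => /(_ isT isT).
  by move/(winj _ _ _ _ hH hH) => [].
rewrite -(@card_in_imset _ _ v); last by move=> h h' hH hH' /(winj _ _ _ _ hH hH')[].
by apply/subset_leq_card/subsetP => _ /imsetP[h hH ->]; apply: vS.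
Qed.

Lemma exists_subset_card (T : finType) (A : {set T}) m :
  m <= #|A| -> exists2 B : {set T}, B \subset A & #|B| = m.
Proof.
rewrite -bin_gt0 -cards_draws => /card_gt0P[B]; rewrite inE => /andP[BA /eqP Bm].
by exists B.
Qed.

(** The sets with exactly one vertex outside [S] correspond to pairs of an
    [(r + 1)]-subset of [S] and a vertex outside it. *)
Lemma star_count_le (V : finType) (S : {set V}) r :
  star_count #|V| r #|S| <= #|[set h : {set V} | (#|h :\: S| <= 1) && (#|h| == r.+2)]|.
Proof.
pose small := [set h : {set V} | h \subset S & #|h| == r.+1].
pose inner := [set h : {set V} | h \subset S & #|h| == r.+2].
pose outer := [set p.2 |: p.1 | p in setX small (~: S)].
have outerS h v : h \in small -> v \in ~: S -> (v |: h) :\: S = [set v] /\ (v |: h) :&: S = h.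
  rewrite !inE => /andP[hS _] vS; split.
    rewrite setDUl (_ : h :\: S = set0) ?setU0; last by apply/eqP; rewrite setD_eq0.
    by apply/setDidPl; rewrite disjoints1.
  rewrite setIUl (setIidPl hS) (_ : [set v] :&: S = set0) ?set0U //.
  by apply/disjoint_setI0; rewrite disjoints1.
have card_outer : #|outer| = 'C(#|S|, r.+1) * (#|V| - #|S|).
  rewrite card_in_imset; last first.
    move=> [h v] [h' v'] /setXP[hs vS] /setXP[hs' vS'] /= E.
    have [D1 I1] := outerS _ _ hs vS; have [D2 I2] := outerS _ _ hs' vS'.
    by rewrite -I1 E I2; congr pair; apply: set1_inj; rewrite -D1 E D2.
  by rewrite cardsX cards_draws [#|~: S|]cardsCs setCK.
have -> : star_count #|V| r #|S| = #|outer| + #|inner|.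
  by rewrite card_outer cards_draws.
have dis : [disjoint outer & inner].
  rewrite -setI_eq0; apply/eqP/setP => A; rewrite in_setI [RHS]inE.
  apply/andP => -[/imsetP[[h v] /setXP[hs vS] ->]]; rewrite inE -setD_eq0.
  by rewrite (outerS _ _ hs vS).1 -cards_eq0 cards1.
have -> : #|outer| + #|inner| = #|outer :|: inner|.
  by rewrite cardsU disjoint_setI0 // cards0 subn0.
apply/subset_leq_card/subsetP => A; rewrite in_setU => /orP[].
  case/imsetP => -[h v] /setXP[hs vS] -> /=; rewrite inE (outerS _ _ hs vS).1 cards1 /=.
  move: hs vS; rewrite !inE => /andP[hS /eqP hr] vS; rewrite cardsU1 hr.
  by rewrite (contra (subsetP hS v)).
rewrite !inE => /andP[AS ->]; rewrite andbT (_ : A :\: S = set0) ?cards0 //.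
by apply/eqP; rewrite setD_eq0.
Qed.

(** * Turan numbers *)

Lemma family_free_bounded (V : finType) (H : {set {set V}}) r k :
  uniform r H -> family_free (berge_family r (matching k.+1)) H -> berge_bounded H k.
Proof.
move=> Hr free H' w H'H [wh winj]; rewrite leqNgt; apply/negP => lt.
pose h (i : 'I_k.+1) := enum_val (widen_ord lt i).
have hH i : h i \in H' by apply: enum_valP.
have hinj : injective h by move=> i j /enum_val_inj/(congr1 val)/= /val_inj.
pose f (p : 'I_k.+1 * bool) := w (h p.1) p.2.
pose phi (e : {set 'I_k.+1 * bool}) :=
  if [pick i | (i, false) \in e] is Some i then h i else set0.
have phiE i : phi [set (i, false); (i, true)] = h i.
  rewrite /phi; case: pickP => [j|/(_ i)]; last by rewrite !inE eqxx.
  by rewrite !inE !xpair_eqE /= !(andbT, andbF, orbF) => /eqP->.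
apply: (free V (phi @: matching k.+1)).
  split.
    by move=> _ /imsetP[_ /imsetP[i _ ->] ->]; rewrite phiE; apply: Hr (subsetP H'H _ _).
  exists f, phi; split => //.
  - by move=> [i b] [j c] /(winj _ _ _ _ (hH i) (hH j))[/hinj -> ->].
  - by move=> _ _ /imsetP[i _ ->] /imsetP[j _ ->]; rewrite !phiE => /hinj ->.
  move=> _ /imsetP[i _ ->]; rewrite phiE; apply/subsetP => _ /imsetP[[j c] jc ->].
  by move: jc; rewrite !inE !xpair_eqE /f /= => /orP[] /andP[/eqP-> _]; apply: wh.
exists id; split => // _ /imsetP[_ /imsetP[i _ ->] ->].
by rewrite imset_id phiE (subsetP H'H).
Qed.

Lemma bounded_family_free (V : finType) (H : {set {set V}}) r k :
  berge_bounded H k -> family_free (berge_family r (matching k.+1)) H.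
Proof.
move=> bnd U B [_ [f [phi [finj phinj phiB fphi]]]] [g [ginj gB]].
pose edge (i : 'I_k.+1) := [set (i, false); (i, true)].
have edgeM i : edge i \in matching k.+1 by apply: imset_f.
have edge_inj : injective edge.
  move=> i j /setP/(_ (i, false)); rewrite !inE !xpair_eqE !eqxx !(andbT, andbF, orbF) /=.
  by move/esym/eqP.
pose h i := g @: phi (edge i).
have hinj : injective h.
  by move=> i j /(imset_inj ginj)/(phinj _ _ (edgeM i) (edgeM j))/edge_inj.
pose w A b := g (f (odflt ord0 [pick i | h i == A], b)).
have wE i b : w (h i) b = g (f (i, b)).
  rewrite /w; case: pickP => [j /eqP/hinj->//|/(_ i)]; by rewrite eqxx.
suff: #|h @: setT| <= k by rewrite card_imset // cardsT card_ord ltnn.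
apply: (bnd _ w).
  by apply/subsetP => _ /imsetP[i _ ->]; apply: gB; rewrite -phiB imset_f.
split.
  move=> _ b /imsetP[i _ ->]; rewrite wE; apply: imset_f.
  apply: (subsetP (fphi _ (edgeM i))); apply: imset_f.
  by rewrite !inE !xpair_eqE eqxx; case: b.
move=> _ b _ b' /imsetP[i _ ->] /imsetP[j _ ->]; rewrite !wE => /ginj/finj[-> ->] //.
Qed.

Lemma turan_number_ge (n r k : nat) (H : hypergraph 'I_n) :
  uniform r H -> berge_bounded H k ->
  #|H| <= turan_number r n (berge_family r (matching k.+1)).
Proof.
move=> Hr /bounded_family_free Hf; rewrite /turan_number.
by apply: (@leq_bigmax_cond _ _ (fun H : hypergraph 'I_n => #|H|)); apply/asboolP.
Qed.

Lemma turan_number_le (n r s : nat) :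
  s.*2.+1 < n ->
  turan_number r.+2 n (berge_family r.+2 (matching s.+1)) <=
  maxn s (maxn 'C(s.*2.+1, r.+2) (star_count n r s)).
Proof.
move=> sn; apply/bigmax_leqP => H /asboolP[Hr Hf].
have := @bounded_upper _ H r s; rewrite card_ord; apply => //.
exact: family_free_bounded Hf.
Qed.

Lemma turan_number_ge_clique (n r s : nat) : s.*2.+1 <= n ->
  'C(s.*2.+1, r) <= turan_number r n (berge_family r (matching s.+1)).
Proof.
move=> sn.
have [W _ Ws] : exists2 W : {set 'I_n}, W \subset setT & #|W| = s.*2.+1.
  by apply: exists_subset_card; rewrite cardsT card_ord.
rewrite -Ws -cards_draws; apply: turan_number_ge; first by move=> h; rewrite inE => /andP[_ /eqP].
by apply: (@bounded_ground _ _ W) => [|h]; rewrite ?Ws // inE => /andP[].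
Qed.

Lemma turan_number_ge_star (n r s : nat) : s <= n ->
  star_count n r s <= turan_number r.+2 n (berge_family r.+2 (matching s.+1)).
Proof.
move=> sn.
have [S _ Ss] : exists2 S : {set 'I_n}, S \subset setT & #|S| = s.
  by apply: exists_subset_card; rewrite cardsT card_ord.
have := star_count_le S r; rewrite card_ord Ss => le; apply: leq_trans le _.
apply: turan_number_ge; first by move=> h; rewrite inE => /andP[_ /eqP].
by apply: (@bounded_cover _ _ S) => [|h]; rewrite ?Ss // inE => /andP[].
Qed.

Lemma turan_number_ge_few (n r s : nat) : s <= 'C(n, r) ->
  s <= turan_number r n (berge_family r (matching s.+1)).
Proof.
move=> sC.
have [H Hsub Hs] : exists2 H : {set {set 'I_n}},
    H \subset [set h : {set 'I_n} | #|h| == r] & #|H| = s.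
  by apply: exists_subset_card; rewrite card_draws card_ord.
rewrite -[X in X <= _]Hs; apply: turan_number_ge; last by apply: bounded_card; rewrite Hs.
by move=> h /(subsetP Hsub); rewrite inE => /eqP.
Qed.

Theorem theorem1p3 (s r n : nat) (hs : 1 <= s) (hr : 2 <= r)
    (hn : 2 * s + 2 <= n) :
  [/\ r <= s + 1 ->
        turan_number r n (berge_family r (matching (s + 1))) =
          maxn 'C(2 * s + 1, r) ('C(s, r - 1) * (n - s) + 'C(s, r)),
      s + 2 <= r <= 2 * s ->
        turan_number r n (berge_family r (matching (s + 1))) = 'C(2 * s + 1, r)
    & 2 * s + 1 <= r -> s <= 'C(n, r) ->
        turan_number r n (berge_family r (matching (s + 1))) = s].
Proof.
case: r hr => [|[|r]] // _; rewrite subSS subn0 !addn1 mul2n.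
have sn : s.*2.+1 < n by lia.
rewrite -/(star_count n r s).
have up := turan_number_le r sn.
have clique := turan_number_ge_clique r.+2 (ltnW sn).
have sn' : s <= n by lia.
have star := turan_number_ge_star r sn'.
have star0 : s < r.+1 -> star_count n r s = 0 by move=> sr; rewrite /star_count !bin_small; lia.
have central : r.+2 <= s.*2 -> s <= 'C(s.*2.+1, r.+2) by apply: leq_bin_central.
split=> [rs|/andP[sr rs]|sr few].
- apply/eqP; rewrite eqn_leq; lia.
- have := star0; lia.
have le1 : 'C(s.*2.+1, r.+2) <= s.
  have: 'C(s.*2.+1, r.+2) <= 1.
    by rewrite -(binn r.+2); apply: leq_bin2l; lia.
  lia.
have := turan_number_ge_few few; have := star0; lia.
Qed.
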